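(* Let $x_k\in\mathbb{R}^n$ and let $D_k$, $g_k$, $\omega_k$, $p_k$, $I_k^-$, $x_k(\alpha)$ be as in the context. For every $\sigma\in(0,1)$ and all sufficiently small $\alpha>0$ (i.e. there exists $\hat\alpha>0$ such that for all $\alpha\in(0,\hat\alpha]$), $$\psi(x_k)-\psi(x_k(\alpha))\ \ge\ \sigma\,\alpha\,(\bar g_k+\bar\omega_k)^T\bar p_k .$$
   Context: Problem: minimize $\psi(x)=f(x)+\gamma\|x\|_1$ over $x\in\mathbb{R}^n$, where $\gamma>0$ and $f:\mathbb{R}^n\to\mathbb{R}$ is Lipschitz continuously differentiable (i.e. $\nabla f$ is Lipschitz) and bounded below. Superscript $i$ denotes the $i$-th component. Given $x_k\in\mathbb{R}^n$, let $g_k=\nabla f(x_k)$. Define the map $\mathcal{P}_k:\mathbb{R}^n\to\mathbb{R}^n$ componentwise by: $\mathcal{P}_k^i(y)=\max\{y^i,0\}$ if $x_k^i>0$, or $x_k^i=0$ and $g_k^i\le-\gamma$; $\mathcal{P}_k^i(y)=\min\{y^i,0\}$ if $x_k^i<0$, or $x_k^i=0$ and $g_k^i\ge\gamma$; $\mathcal{P}_k^i(y)=0$ if $x_k^i=0$ and $|g_k^i|<\gamma$. Define the vector $\omega_k\in\mathbb{R}^n$ by: $\omega_k^i=\gamma$ if $x_k^i>0$, or $x_k^i=0$ and $g_k^i\le-\gamma$; $\omega_k^i=-\gamma$ if $x_k^i<0$, or $x_k^i=0$ and $g_k^i\ge\gamma$; $\omega_k^i=0$ if $x_k^i=0$ and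 $|g_k^i|<\gamma$. Let $I_k^+=\{i: x_k^i=0,\ |g_k^i|<\gamma\}$ and $I_k^-=\{1,\dots,n\}\setminus I_k^+$. $D_k\in\mathbb{R}^{n\times n}$ is a symmetric positive definite matrix that is diagonal with respect to $I_k^+$, i.e. $D_k[i,j]=0$ for all $i\in I_k^+$ and $j\neq i$. Let $p_k=D_k(g_k+\omega_k)$ and $x_k(\alpha)=\mathcal{P}_k(x_k-\alpha p_k)$ for $\alpha>0$. $\bar g_k,\bar p_k,\bar\omega_k$ denote the subvectors of $g_k,p_k,\omega_k$ indexed by $I_k^-$. *)

(* Defs.v *)
From HB Require Import structures.
From mathcomp Require Import all_boot all_order all_algebra.
From mathcomp Require Import all_classical all_reals all_analysis.

Set Implicit Arguments.
Unset Strict Implicit.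
Unset Printing Implicit Defensive.

Import Order.TTheory GRing.Theory Num.Theory.
Import numFieldNormedType.Exports.

Local Open Scope classical_set_scope.
Local Open Scope ring_scope.

(* R^n is 'cV[R]_n.  The library norm `|x| on matrices is the sup norm, hence
   the explicit Euclidean and l1 norms. *)

Definition norm1 (R : realType) (n : nat) (x : 'cV[R]_n) : R :=
  \sum_(i < n) `|x i 0|.

Definition norm2 (R : realType) (n : nat) (x : 'cV[R]_n) : R :=
  Num.sqrt (\sum_(i < n) x i 0 ^+ 2).

Definition gradient (R : realType) (n : nat) (f : 'cV[R]_n -> R)
    (x : 'cV[R]_n) : 'cV[R]_n :=
  \col_(i < n) 'D_(delta_mx i 0) f x.

Definition lipschitz_differentiable (R : realType) (n : nat)
    (f : 'cV[R]_n -> R) : Prop :=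
  (forall x, differentiable f x) /\
  exists L : R, forall x y,
    norm2 (gradient f x - gradient f y) <= L * norm2 (x - y).

Definition bounded_below (R : realType) (n : nat) (f : 'cV[R]_n -> R) : Prop :=
  has_lbound (range f).

Definition psi (R : realType) (n : nat) (f : 'cV[R]_n -> R) (gamma : R)
    (x : 'cV[R]_n) : R :=
  f x + gamma * norm1 x.

(* In the next three definitions xi and gi are the i-th components of the
   current point and of the gradient there.  For gamma > 0 exactly one of the
   three tests holds. *)

Definition pos_case (R : realType) (gamma xi gi : R) : bool :=
  (0 < xi) || (xi == 0) && (gi <= - gamma).

Definition neg_case (R : realType) (gamma xi gi : R) : bool :=
  (xi < 0) || (xi == 0) && (gamma <= gi).

Definition zero_case (R : realType) (gamma xi gi : R) : bool :=
  (xi == 0) && (`|gi| < gamma).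

(* The final [else] branches below are the components satisfying zero_case. *)

Definition orthant_proj (R : realType) (n : nat) (gamma : R) (x g y : 'cV[R]_n) :
    'cV[R]_n :=
  \col_(i < n)
    if pos_case gamma (x i 0) (g i 0) then Num.max (y i 0) 0
    else if neg_case gamma (x i 0) (g i 0) then Num.min (y i 0) 0
    else 0.

Definition omega (R : realType) (n : nat) (gamma : R) (x g : 'cV[R]_n) :
    'cV[R]_n :=
  \col_(i < n)
    if pos_case gamma (x i 0) (g i 0) then gamma
    else if neg_case gamma (x i 0) (g i 0) then - gamma
    else 0.

Definition Iplus (R : realType) (n : nat) (gamma : R) (x g : 'cV[R]_n) :
    {set 'I_n} :=
  [set i | zero_case gamma (x i 0) (g i 0)]%SET.

Definition Iminus (R : realType) (n : nat) (gamma : R) (x g : 'cV[R]_n) :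
    {set 'I_n} :=
  (~: Iplus gamma x g)%SET.

Definition subvec (R : realType) (n : nat) (I : {set 'I_n}) (v : 'cV[R]_n) :
    'cV[R]_#|I| :=
  rowsub (fun k : 'I_#|I| => enum_val k) v.

Definition symmetric_posdef (R : realType) (n : nat) (D : 'M[R]_n) : Prop :=
  D^T = D /\ forall v : 'cV[R]_n, v != 0 -> 0 < (v^T *m D *m v) 0 0.

Definition diagonal_wrt (R : realType) (n : nat) (I : {set 'I_n})
    (D : 'M[R]_n) : Prop :=
  forall i j, i \in I -> j != i -> D i j = 0.

Definition direction (R : realType) (n : nat) (gamma : R) (x g : 'cV[R]_n)
    (D : 'M[R]_n) : 'cV[R]_n :=
  D *m (g + omega gamma x g).

Definition proj_arc (R : realType) (n : nat) (gamma : R) (x g : 'cV[R]_n)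
    (D : 'M[R]_n) (alpha : R) : 'cV[R]_n :=
  orthant_proj gamma x g (x - alpha *: direction gamma x g D).

(* Main.v *)
Require Import Defs.
From HB Require Import structures.
From mathcomp Require Import all_boot all_order all_algebra.
From mathcomp Require Import all_classical all_reals all_analysis.
From mathcomp Require Import lra.
Import Order.TTheory GRing.Theory Num.Theory.
Import numFieldNormedType.Exports.
Local Open Scope classical_set_scope.
Local Open Scope ring_scope.

(** The idea is that near [alpha = 0] the projected arc is a straight half-line:
    [x(alpha) = x + alpha q] for a fixed vector [q], namely the projection of
    [- p] onto the tangent cone at [x] of the orthant face on which the arc is
    confined ([arc_tangent], [near_proj_arcE]).  The theorem thus reduces to a
    statement about the one-sided directional derivative of [psi] along [q].

    On that orthant face the l1 term is linear: [gamma |y|_1 = omega . y] both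
    for [y = x] and for every [y] in the range of the projection
    ([gamma_norm1_orthant_proj], [gamma_norm1_base]), so that the directional
    derivative of [psi] along [q] is [(g + omega) . q].

    Componentwise, [- (g + omega)_i q_i] is at least [(g + omega)_i p_i] on
    [I^-] and at least [0] on [I^+] ([slope_decrease]): when [x_i <> 0] one has
    [q_i = - p_i]; when [x_i = 0] and [i] is in [I^-], the projection can only
    discard a component of [- p] along which [(g + omega)_i p_i <= 0]; and
    [q_i = 0] on [I^+].  Hence the rate of decrease
    of [psi] along [q] is at least [S], the inner product over [I^-] of
    [g + omega] and [p].

    Since [D] is diagonal with respect to [I^+], [S] is the quadratic form of [D]
    at the vector [g + omega] with its [I^+] components erased
    ([subvec_direction_quadform]).  If that vector is nonzero then [S > 0], and
    the slack [(1 - sigma) S > 0] absorbs the first-order Taylor remainder of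
    [f].  If it is zero then [p] vanishes on [I^-], so [q = 0], the arc is
    constant for small [alpha] and both sides vanish. *)

(** * Directional derivatives *)

Lemma derive_gradient {R : realType} {n : nat} {f : 'cV[R]_n -> R}
    {x : 'cV[R]_n} (q : 'cV[R]_n) :
  differentiable f x -> 'D_q f x = \sum_i gradient f x i 0 * q i 0.
Proof.
move=> df; rewrite deriveE // [q in LHS]matrix_sum_delta linear_sum /=.
apply: eq_bigr => i _; rewrite big_ord1 linearZ /= mxE deriveE //.
by rewrite mulrC.
Qed.

Lemma near_taylor_upper {R : realType} {n : nat} {f : 'cV[R]_n -> R}
    {x q : 'cV[R]_n} {e : R} : differentiable f x -> 0 < e ->
  \forall a \near 0^'+, f (x + a *: q) - f x < a * ('D_q f x + e).
Proof.
move=> df e0.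
have dfq : derivable f x q by exact: diff_derivable.
have lim0 : (a^-1 *: (f (a *: q + x) - f x)) @[a --> 0^'+] --> 'D_q f x.
  by apply: cvg_dnbhs_at_right; exact: dfq.
near=> a.
have a0 : 0 < a by near: a; exact: nbhs_right_gt.
rewrite -ltr_pdivrMl // addrC [x + _]addrC addrC.
near: a.
apply: (cvgr_lt _ lim0); by rewrite ltrDl.
Unshelve. all: by end_near. Qed.

(** * The projected arc near its base point *)

(** Scalar forms of [orthant_proj] and [omega]: the projected arc decouples
    over the components, so its analysis is one-dimensional. *)
Definition proj1 {R : realType} (gamma xi gi z : R) : R :=
  if pos_case gamma xi gi then Num.max z 0
  else if neg_case gamma xi gi then Num.min z 0 else 0.

Definition omega1 {R : realType} (gamma xi gi : R) : R :=
  if pos_case gamma xi gi then gamma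
  else if neg_case gamma xi gi then - gamma else 0.

(** The right derivative at [0] of [a |-> proj1 gamma xi gi (xi - a * pi)]: the
    projection is inactive near [a = 0] when [xi <> 0] and is positively homogeneous when
    [xi = 0]. *)
Definition slope {R : realType} (gamma xi gi pi : R) : R :=
  if xi == 0 then proj1 gamma xi gi (- pi) else - pi.

Definition arc_tangent {R : realType} {n : nat} (gamma : R)
    (x g p : 'cV[R]_n) : 'cV[R]_n :=
  \col_(i < n) slope gamma (x i 0) (g i 0) (p i 0).

Lemma near_proj1E {R : realType} (gamma xi gi pi : R) :
  \forall a \near 0^'+,
    proj1 gamma xi gi (xi - a * pi) = xi + a * slope gamma xi gi pi.
Proof.
have lim0 : (xi - a * pi) @[a --> 0^'+] --> xi.
  rewrite -[X in _ --> X]subr0 -[X in _ - X](mul0r pi).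
  apply: cvgB; first exact: cvg_cst.
  by apply: cvgMl; apply: cvg_at_right_filter; exact: cvg_id.
rewrite /slope /proj1 /pos_case /neg_case.
case: (ltrgtP xi 0) => [xi0|xi0|->].
- near=> a.
  have xa : xi - a * pi < 0 by near: a; exact: (cvgr_lt _ lim0).
  by rewrite /= (min_idPl (ltW xa)) mulrN.
- near=> a.
  have xa : 0 < xi - a * pi by near: a; exact: (cvgr_gt _ lim0).
  by rewrite /= (max_idPl (ltW xa)) mulrN.
- near=> a.
  have a0 : 0 <= a by near: a; exact: nbhs_right_ge.
  rewrite /= sub0r add0r -mulrN.
  case: ifP => _; first by rewrite -[in LHS](mulr0 a) maxr_pMr.
  by case: ifP => _; rewrite ?mulr0 // -[in LHS](mulr0 a) minr_pMr.
Unshelve. all: by end_near. Qed.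

Lemma near_proj_arcE {R : realType} {n : nat} (gamma : R) (x g : 'cV[R]_n)
    (D : 'M[R]_n) :
  \forall a \near 0^'+,
    proj_arc gamma x g D a
      = x + a *: arc_tangent gamma x g (direction gamma x g D).
Proof.
set p := direction gamma x g D.
have H : \forall a \near 0^'+, forall i : 'I_n,
    proj1 gamma (x i 0) (g i 0) (x i 0 - a * p i 0)
      = x i 0 + a * slope gamma (x i 0) (g i 0) (p i 0).
  by apply: filter_forall => i; exact: near_proj1E.
apply: filterS H => a Ha; apply/colP => i.
by have := Ha i; rewrite /proj1 !mxE -/p => <-.
Qed.

(** * Linearity of the penalty on the orthant face *)

Lemma gamma_norm_proj1 {R : realType} (gamma xi gi z : R) :
  gamma * `|proj1 gamma xi gi z| = omega1 gamma xi gi * proj1 gamma xi gi z.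
Proof.
rewrite /proj1 /omega1; case: ifP => _.
  by rewrite ger0_norm ?le_max ?lexx ?orbT.
case: ifP => _; last by rewrite normr0 !mulr0.
by rewrite ler0_norm ?ge_min ?lexx ?orbT // mulrN mulNr.
Qed.

(** When [xi = 0] the value of [omega1] depends on [gi], but both sides are
    zero whatever it is. *)
Lemma gamma_norm_base {R : realType} (gamma xi gi : R) :
  gamma * `|xi| = omega1 gamma xi gi * xi.
Proof.
rewrite /omega1 /pos_case /neg_case.
case: (ltrgtP xi 0) => [xi0|xi0|->] /=; last by rewrite normr0 !mulr0.
- by rewrite ltr0_norm // mulrN mulNr.
- by rewrite gtr0_norm.
Qed.

Lemma gamma_norm1_orthant_proj {R : realType} {n : nat} (gamma : R)
    (x g y : 'cV[R]_n) (z := orthant_proj gamma x g y) :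
  gamma * norm1 z = \sum_i omega gamma x g i 0 * z i 0.
Proof.
rewrite mulr_sumr; apply: eq_bigr => i _.
by have := gamma_norm_proj1 gamma (x i 0) (g i 0) (y i 0); rewrite /z !mxE.
Qed.

Lemma gamma_norm1_base {R : realType} {n : nat} (gamma : R)
    (x g : 'cV[R]_n) :
  gamma * norm1 x = \sum_i omega gamma x g i 0 * x i 0.
Proof.
rewrite mulr_sumr; apply: eq_bigr => i _.
by have := gamma_norm_base gamma (x i 0) (g i 0); rewrite mxE.
Qed.

(** * Rate of decrease along the tangent *)

(** The signs agree because at [xi = 0] the test selecting the half-line of
    [proj1] also fixes the sign of [gi + omega1 gamma xi gi]: nonpositive on the
    nonnegative half-line, nonnegative on the nonpositive one. *)
Lemma slope_decrease {R : realType} (gamma xi gi pi : R) : 0 < gamma ->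
  (if zero_case gamma xi gi then 0 else (gi + omega1 gamma xi gi) * pi)
    <= - ((gi + omega1 gamma xi gi) * slope gamma xi gi pi).
Proof.
move=> gamma0.
rewrite /zero_case /slope /proj1 /omega1 /pos_case /neg_case.
case: (ltrgtP xi 0) => _ /=; rewrite ?mulrN ?opprK //.
rewrite real_ltr_norml ?num_real //.
case: (leP gi (- gamma)) => [gile|gigt] /=.
  rewrite -mulrN oppr_max opprK oppr0; case: (leP pi 0) => pi0 //.
  by rewrite mulr0 mulr_le0_ge0 //; lra.
case: (leP gamma gi) => [gige|gilt] /=; last by rewrite mulr0 oppr0.
rewrite -mulrN oppr_min opprK oppr0; case: (leP pi 0) => pi0 //.
by rewrite mulr0 mulr_ge0_le0 //; lra.
Qed.

(** * The quadratic form over the free indices *)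

Lemma subvec_dotE {R : realType} {n : nat} (I : {set 'I_n}) (u w : 'cV[R]_n) :
  ((subvec I u)^T *m subvec I w) 0 0 = \sum_(i in I) u i 0 * w i 0.
Proof.
rewrite mxE [RHS]big_enum_val /=.
by apply: eq_bigr => k _; rewrite !mxE.
Qed.

Definition erase {R : realType} {n : nat} (I : {set 'I_n}) (u : 'cV[R]_n) :
    'cV[R]_n :=
  \col_(i < n) if i \in I then 0 else u i 0.

(** Symmetry turns the vanishing rows of [D] into vanishing columns, so erased
    entries do not contribute to the other components of the image. *)
Lemma mulmx_erase {R : realType} {n : nat} {D : 'M[R]_n} {I : {set 'I_n}}
    (u : 'cV[R]_n) i : D^T = D -> diagonal_wrt I D -> i \notin I ->
  (D *m u) i 0 = (D *m erase I u) i 0.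
Proof.
move=> symD diagD iI; rewrite !mxE; apply: eq_bigr => j _; rewrite mxE.
case: ifP => // jI; rewrite -symD mxE diagD ?mul0r //.
by apply: contraNneq iI => ->.
Qed.

Lemma subvec_direction_quadform {R : realType} {n : nat} {D : 'M[R]_n}
    {I : {set 'I_n}} (u : 'cV[R]_n) : D^T = D -> diagonal_wrt I D ->
  \sum_(i in ~: I) u i 0 * (D *m u) i 0
    = ((erase I u)^T *m D *m erase I u) 0 0.
Proof.
move=> symD diagD; rewrite -mulmxA mxE big_mkcond /=.
apply: eq_bigr => i _; rewrite inE [in RHS]mxE [in RHS]mxE.
case: ifPn => [iI|/negbNE iI]; last by rewrite iI mul0r.
by rewrite (negbTE iI) (mulmx_erase _ _ symD diagD).
Qed.

(** * Sufficient decrease *)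

Theorem theorem5 (R : realType) (n : nat) (f : 'cV[R]_n -> R) (gamma : R)
    (hgamma : 0 < gamma)
    (hf : lipschitz_differentiable f) (hfb : bounded_below f)
    (xk : 'cV[R]_n) (Dk : 'M[R]_n) (hD : symmetric_posdef Dk)
    (hDdiag : diagonal_wrt (Iplus gamma xk (gradient f xk)) Dk) :
  let gk := gradient f xk in
  let wk := omega gamma xk gk in
  let pk := direction gamma xk gk Dk in
  let Im := Iminus gamma xk gk in
  forall sigma : R, 0 < sigma < 1 ->
  exists2 alpha_hat : R, 0 < alpha_hat &
    forall alpha : R, 0 < alpha <= alpha_hat ->
      psi f gamma xk - psi f gamma (proj_arc gamma xk gk Dk alpha) >=
      sigma * alpha *
        ((subvec Im gk + subvec Im wk)^T *m subvec Im pk) 0 0.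
Proof.
move=> gk wk pk Im sigma /andP[_ sigma1].
have dfx : differentiable f xk by case: hf.
have [symD posD] := hD.
suff H : \forall a \near 0^'+,
    sigma * a * ((subvec Im gk + subvec Im wk)^T *m subvec Im pk) 0 0
      <= psi f gamma xk - psi f gamma (proj_arc gamma xk gk Dk a).
  have [e /= e0 He] := H.
  (* The neighbourhood is an open ball of radius e; alpha_hat must lie in it. *)
  exists (e / 2); first by rewrite divr_gt0.
  move=> a /andP[a0 ale]; apply: He => //=.
  rewrite sub0r normrN gtr0_norm // (le_lt_trans ale) //.
  by rewrite ltr_pdivrMr // mulr_natr mulr2n ltrDl.
have -> : subvec Im gk + subvec Im wk = subvec Im (gk + wk).
  by apply/colP => k; rewrite !mxE.
rewrite subvec_dotE.
set S := \sum_(i in Im) _.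
pose q := arc_tangent gamma xk gk pk.
pose v := erase (Iplus gamma xk gk) (gk + wk).
have SE : S = (v^T *m Dk *m v) 0 0 by exact: subvec_direction_quadform.
have dec : S <= - \sum_i (gk + wk) i 0 * q i 0.
  rewrite -sumrN /S big_mkcond /=; apply: ler_sum => i _.
  have := slope_decrease gamma (xk i 0) (gk i 0) (pk i 0) hgamma.
  rewrite !inE /q /wk /omega1 !mxE if_neg; exact.
have arcE : \forall a \near 0^'+, proj_arc gamma xk gk Dk a = xk + a *: q.
  exact: near_proj_arcE.
have [v0|v0] := eqVneq v 0.
  (* Degenerate case: p vanishes on I^- and the projection is 0 on I^+. *)
  have q0 : q = 0.
    apply/colP => i; rewrite [LHS]mxE [RHS]mxE /slope /proj1.
    have [zi|nzi] := boolP (zero_case gamma (xk i 0) (gk i 0)).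
      move: zi; rewrite /zero_case /pos_case /neg_case => /andP[/eqP-> ].
      rewrite eqxx ltxx /= real_ltr_norml ?num_real // => /andP[g1 g2].
      by rewrite leNgt g1 leNgt g2.
    have -> : pk i 0 = 0.
      rewrite /pk /direction (mulmx_erase _ _ symD hDdiag) ?inE //.
      by rewrite -/v v0 mulmx0 mxE.
    by rewrite oppr0 maxxx minxx !if_same.
  apply: filterS arcE => a ->.
  by rewrite q0 scaler0 addr0 subrr SE v0 mulmx0 mxE mulr0.
have S0 : 0 < S by rewrite SE; exact: posD.
have slack : 0 < (1 - sigma) * S by rewrite mulr_gt0 ?subr_gt0.
near=> a.
have a0 : 0 < a by near: a; exact: nbhs_right_gt.
have fa : f (xk + a *: q) - f xk < a * ('D_q f xk + (1 - sigma) * S).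
  by near: a; exact: near_taylor_upper.
have aE : proj_arc gamma xk gk Dk a = xk + a *: q by near: a.
have pen : gamma * norm1 (proj_arc gamma xk gk Dk a) - gamma * norm1 xk
    = a * \sum_i wk i 0 * q i 0.
  rewrite gamma_norm1_orthant_proj (gamma_norm1_base gamma xk gk) -sumrB.
  rewrite mulr_sumr; apply: eq_bigr => i _.
  rewrite -/(proj_arc gamma xk gk Dk a) aE [(xk + _) i 0]mxE [(a *: q) i 0]mxE.
  by rewrite mulrDr addrC addrA addNr add0r mulrCA.
have split : \sum_i (gk + wk) i 0 * q i 0
    = 'D_q f xk + \sum_i wk i 0 * q i 0.
  rewrite (derive_gradient _ dfx) -big_split /=; apply: eq_bigr => i _.
  by rewrite [(gk + wk) i 0]mxE mulrDl.
rewrite /psi aE; rewrite aE in pen; rewrite split in dec.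
(* The Taylor slack a (1 - sigma) S is what is given up from a S. *)
have := ler_wpM2l (ltW a0) dec; nra.
Unshelve. all: by end_near. Qed.
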